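(* Let $(X,d,a)$ be an O-metric space. Then the O-metric topology of $(X,d,a)$ can be generated by an upward O-metric on $X$; that is, there is an upward O-metric on $X$ whose O-metric topology coincides with the O-metric topology induced by $d$.
   Context: $\mathbb{R}_+=[0,\infty)$. Let $X$ be a non-empty set, $a\in\mathbb{R}_+$, $I_a\subset\mathbb{R}_+$ an interval containing $a$, and $\mathbf{o}:I_a\times I_a\to\mathbb{R}_+$ a function. A function $d:X\times X\to I_a$ is an O-metric (more precisely an $\mathbf{o}$-metric) on $X$, and $(X,d,a)$ is an O-metric space, if for all $x,y,z\in X$: (i) $d(x,y)=a$ if and only if $x=y$; (ii) $d(x,y)=d(y,x)$; (iii) $d(x,z)\le \mathbf{o}(d(x,y),d(y,z))$. An O-metric space for which such $\mathbf{o}$ and $I_a$ exist is the general object considered. The O-metric (space) is called ($a$-)upward if $I_a\subset[a,\infty)$ (without loss of generality $I_a=[a,\infty)$). For $x\in X$ and $r>0$, the open ball is $B(x,r)=\{y\in X: |d(x,y)-a|<r\}$. The O-metric topology (topology induced or generated by $d$) is $\{A\subset X: \forall x\in A\ \exists r>0,\ B(x,r)\subset A\}$. *)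

(* Defs.v *)
From mathcomp Require Import all_boot all_order all_algebra.
From mathcomp Require Import all_classical all_reals all_analysis.

Set Implicit Arguments.
Unset Strict Implicit.
Unset Printing Implicit Defensive.

Import Order.TTheory GRing.Theory Num.Theory.

Local Open Scope classical_set_scope.
Local Open Scope ring_scope.

(* Functions into or out of the interval [I] are total functions on [R]
   constrained on [I] only: [o] is arbitrary outside [I x I].
   [0 <= a] follows from [o_metric_base] and [o_metric_nonneg]. *)
Record o_metric_on (R : realType) (X : Type) (a : R) (I : set R)
    (o : R -> R -> R) (d : X -> X -> R) : Prop := OMetricOn {
  o_metric_interval : is_interval I ;
  o_metric_base : I a ;
  o_metric_nonneg : I `<=` `[0, +oo[ ;
  o_metric_bound_ge0 : forall u v, I u -> I v -> 0 <= o u v ;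
  o_metric_range : forall x y, I (d x y) ;
  o_metric_eq : forall x y, d x y = a <-> x = y ;
  o_metric_sym : forall x y, d x y = d y x ;
  o_metric_triangle : forall x y z, d x z <= o (d x y) (d y z)
}.

Definition o_metric (R : realType) (X : Type) (a : R) (d : X -> X -> R) : Prop :=
  exists (I : set R) (o : R -> R -> R), o_metric_on a I o d.

Definition upward_o_metric (R : realType) (X : Type) (a : R)
    (d : X -> X -> R) : Prop :=
  exists (I : set R) (o : R -> R -> R),
    o_metric_on a I o d /\ I `<=` `[a, +oo[.

Definition o_ball (R : realType) (X : Type) (a : R) (d : X -> X -> R)
    (x : X) (r : R) : set X :=
  [set y | `|d x y - a| < r].

Definition o_topology (R : realType) (X : Type) (a : R) (d : X -> X -> R) :
    set (set X) :=
  [set A | forall x, A x -> exists2 r : R, 0 < r & o_ball a d x r `<=` A].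

(* Main.v *)
(** Replace [d] by [e = a + |d - a|], which has the same balls as [d]. If
    [e x y = u], then [d x y] is [u] or its mirror image [2a - u], so [e x z]
    is controlled by the four values of [o] at such pairs; as [d >= 0], one has
    [e x z <= 2a + d x z]. *)
Require Import Defs.
From mathcomp Require Import all_boot all_order all_algebra.
From mathcomp Require Import all_classical all_reals all_analysis.
From mathcomp Require Import lra.

Import Order.TTheory GRing.Theory Num.Theory.

Local Open Scope classical_set_scope.
Local Open Scope ring_scope.

Definition fold_at {R : realType} (a t : R) : R := a + `|t - a|.

(* Absolute values because [o] may be negative off [I x I], where the mirrored
   arguments may fall. *)
Definition mirrored_bound {R : realType} (a : R) (o : R -> R -> R) (u v : R) : R :=
  a + a + (`|o u v| + `|o u (a + a - v)|
           + `|o (a + a - u) v| + `|o (a + a - u) (a + a - v)|).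

Lemma fold_at_mirror {R : realType} (a t : R) :
  t = fold_at a t \/ t = a + a - fold_at a t.
Proof.
rewrite /fold_at; have [h|h] := leP a t.
  by left; rewrite ger0_norm; lra.
by right; rewrite ltr0_norm; lra.
Qed.

(** Each of [s], [t] is its folded value or the mirror image of that value, so [o s t] is one of the
    four numbers whose absolute values are summed. *)
Lemma le_mirrored_bound {R : realType} (a : R) (o : R -> R -> R) (s t : R) :
  a + a + o s t <= mirrored_bound a o (fold_at a s) (fold_at a t).
Proof.
rewrite /mirrored_bound lerD2l.
set u := fold_at a s; set v := fold_at a t.
have n1 := normr_ge0 (o u v); have n2 := normr_ge0 (o u (a + a - v)).
have n3 := normr_ge0 (o (a + a - u) v).
have n4 := normr_ge0 (o (a + a - u) (a + a - v)).
apply: le_trans (ler_norm _) _.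
(* The abbreviations [u] and [v] shield the right-hand side, so only the arguments of [o s t] get
   rewritten. *)
by case: (fold_at_mirror a s) => ->; case: (fold_at_mirror a t) => ->;
  rewrite -/u -/v; lra.
Qed.

Lemma upward_fold {R : realType} {X : Type} (a : R) (d : X -> X -> R) :
  o_metric a d -> upward_o_metric a (fun x y => fold_at a (d x y)).
Proof.
move=> [I [obnd [_ Ia Inneg _ dI dE dC dT]]].
have ge0 t : I t -> 0 <= t by move=> /Inneg /=; rewrite in_itv /= andbT.
have a0 := ge0 _ Ia.
(* [I] cannot be kept: mirroring a value below [a] may leave it, as when [I] is [[0, a]]. *)
exists (`[a, +oo[)%classic, (mirrored_bound a obnd); split => //; split.
- exact: interval_is_interval.
- by rewrite /= in_itv /= lexx.
- by move=> t /=; rewrite !in_itv /= !andbT; exact: le_trans.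
- by move=> u v _ _; rewrite /mirrored_bound !addr_ge0.
- by move=> x y; rewrite /= in_itv /= andbT lerDl.
- move=> x y; rewrite -dE /fold_at; split => [/eqP|->].
    by rewrite -subr_eq0 addrC addKr normr_eq0 subr_eq0 => /eqP.
  by rewrite subrr normr0 addr0.
- by move=> x y; rewrite dC.
- move=> x y z; apply: (le_trans _ (le_mirrored_bound _ _ _ _)).
  (* With [t = d x z], the fold is [t <= 2a + t] if [a <= t], and [2a - t <= 2a + t] otherwise;
     these use [0 <= a] and [0 <= t] respectively. *)
  have := dT x y z; have := ge0 _ (dI x z); rewrite /fold_at.
  by have [h|h] := leP a (d x z); [rewrite ger0_norm|rewrite ltr0_norm]; lra.
Qed.

(** A ball sees a value only through its distance to [a], which folding preserves. *)
Lemma o_topology_fold {R : realType} {X : Type} (a : R) (d : X -> X -> R) :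
  o_topology a (fun x y => fold_at a (d x y)) = o_topology a d.
Proof.
have ballE x r : o_ball a (fun x y => fold_at a (d x y)) x r = o_ball a d x r.
  by apply/funext => y; rewrite /o_ball /= /fold_at addrC addKr normr_id.
by apply/seteqP; split=> A hA x /hA [r r0 rA]; exists r; rewrite // ?ballE // -ballE.
Qed.

Theorem theorem2p33 (R : realType) (X : Type) (hX : [set: X] !=set0)
    (a : R) (d : X -> X -> R) (hd : o_metric a d) :
  exists (b : R) (e : X -> X -> R),
    upward_o_metric b e /\ o_topology b e = o_topology a d.
Proof.
exists a, (fun x y => fold_at a (d x y)).
by split; [exact: upward_fold | exact: o_topology_fold].
Qed.
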